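(* Let $F$ be a distribution function on $\mathbb{R}$ of the form $F=\exp\{-e^{-\phi}\}$, let $\omega_F:=\sup\{x\in\mathbb{R}: F(x)<1\}\in(-\infty,\infty]$, let $\alpha\in\mathbb{R}$, and assume one of the following three cases: (i) $\alpha>0$, $\omega_F=\infty$, $\phi$ is a $C^1$-function with $\phi'>0$ in a neighborhood of $\infty$, and $h_\alpha(x):=x\phi'(x)-\alpha$ for $x>0$; (ii) $\alpha<0$, $\omega_F<\infty$, $\phi$ is a $C^1$-function with $\phi'>0$ in a left neighborhood of $\omega_F$, and $h_\alpha(x):=(\omega_F-x)\phi'(x)+\alpha$ for $x<\omega_F$; (iii) $\alpha=0$, $\omega_F\le\infty$, $\phi$ is a twice differentiable function with $\phi'>0$ in a (left) neighborhood of $\omega_F$, and $h_0(x):=(1/\phi')'(x)$ for $x<\omega_F$. Assume that there exists a non-increasing function $g$ such that $g(x)\to0$ as $x\to\omega_F$ and $|h_\alpha(x)|\le g(x)$ for all $x$ in the domain of $h_\alpha$. For normalizing constants $a_n>0$, $b_n\in\mathbb{R}$, let $w_n$ denote the density of $x\mapsto F_n(a_nx+b_n)$, where $F_n:=\max\{nF-(n-1),0\}$ is the $n$-fold free max-convolution power of $F$. Then the following hold. 1. In case (i): if $a_n>0$ satisfies $F(a_n)=e^{-1/n}$ and $b_n=0$, then $$\sup_{x>1}|w_n(x)-\varphi_\alpha^{\rm free}(x)|\le O\big(n^{-1}\vee g(a_n)\big)\quad\text{as } n\to\infty.$$ 2. In case (ii) with $\alpha<-1$: if $a_n>0$ satisfies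 $F(\omega_F-a_n)=e^{-1/n}$ and $b_n=\omega_F$, then $$\sup_{-1<x<0}|w_n(x)-\varphi_\alpha^{\rm free}(x)|\le O\big(n^{-1}\vee g(\omega_F-a_n)\big)\quad\text{as } n\to\infty.$$ This does not hold for $\alpha<0$ in general: if $-1/2<\alpha<0$ and $F(x)=\exp(-(-x)^{-\alpha})\mathbf{1}_{(-\infty,0)}(x)+\mathbf{1}_{[0,\infty)}(x)$ (so that $\omega_F=0$ and $h_\alpha\equiv 0$), then, with $a_n,b_n$ chosen in this way, $w_n$ does not converge uniformly to $\varphi_\alpha^{\rm free}$ on $(-1,0)$. 3. In case (iii): if $b_n\in\mathbb{R}$ satisfies $F(b_n)=e^{-1/n}$ and $a_n=\dfrac{F(b_n)}{nF'(b_n)}$, then $$\sup_{x>0}|w_n(x)-\varphi_0^{\rm free}(x)|\le O\big(n^{-1}\vee g(b_n)\big)\quad\text{as } n\to\infty.$$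
   Context: Notation: $s\vee t=\max\{s,t\}$. A bound $\sup|\cdot|\le O(c_n)$ means that there are a constant $C>0$ and $N\in\mathbb{N}$ (depending on $F,\alpha,g$ but not on $x$) with $\sup|\cdot|\le C c_n$ for all $n\ge N$. The function $\phi$ is $\phi=-\log(-\log F)$, and the conditions on $\phi$ and $h_\alpha$ concern points $x$ with $0<F(x)<1$. In terms of $F$, $\phi'(x)=\dfrac{F'(x)}{F(x)(-\log F(x))}$. Free max-convolution: for distribution functions $F,G$ on $\mathbb{R}$ it is $\max\{F+G-1,0\}$; the $n$-fold power of $F$ is $F_n=\max\{nF-(n-1),0\}$. The density $w_n$ of $x\mapsto F_n(a_nx+b_n)$ is given by $w_n(x)=na_nF'(a_nx+b_n)$ for those $x$ with $F(a_nx+b_n)>1-\frac1n$ and $a_nx+b_n<\omega_F$, and $w_n(x)=0$ for $a_nx+b_n\ge\omega_F$ (if $\omega_F<\infty$). For all sufficiently large $n$ this determines $w_n$ on the sets over which the suprema are taken. Free extreme value densities: $$\varphi_\alpha^{\rm free}(x)=\begin{cases}\alpha x^{-\alpha-1}\mathbf{1}_{(1,\infty)}(x), & \alpha>0,\\ -\alpha(-x)^{-\alpha-1}\mathbf{1}_{(-1,0)}(x), & \alpha<0,\\ e^{-x}\mathbf{1}_{(0,\infty)}(x), & \alpha=0.\end{cases}$$ *)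

(* Defs.v *)
From HB Require Import structures.
From mathcomp Require Import all_boot all_order all_algebra.
From mathcomp Require Import all_classical all_reals all_analysis.
From mathcomp Require Import lra.

Set Implicit Arguments.
Unset Strict Implicit.
Unset Printing Implicit Defensive.

Import Order.TTheory GRing.Theory Num.Theory.
Import numFieldNormedType.Exports.

Local Open Scope ring_scope.
Local Open Scope classical_set_scope.

Section von_mises.
Context {R : realType}.
Implicit Types (F G g h : R -> R) (D : set R) (alpha w : R).

(* F = exp (- exp (- phi)) where 0 < F < 1; junk elsewhere, since ln vanishes
   on nonpositive reals. *)
Definition phi F (x : R) : R := - ln (- ln (F x)).

Definition omega F : \bar R := ereal_sup [set x%:E | x in [set x | F x < 1]].

(* Left neighborhoods of a point of ]-oo, +oo]; the value at -oo is immaterial,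
   as omega F is never -oo for a distribution function F. *)
Definition left_nbhs (w : \bar R) : set_system R :=
  match w with
  | r%:E => r^'-
  | _ => +oo
  end.

#[global] Instance left_nbhs_filter (w : \bar R) : ProperFilter (left_nbhs w).
Proof. by case: w => [r| |] /=; exact: _. Qed.

(* The open set on which phi is a genuine (not a junk) value. *)
Definition supp F : set R := interior [set x | 0 < F x < 1].

Definition C1_at (f : R -> R) (x : R) : Prop :=
  derivable f x 1 /\ {for x, continuous (derive1 f)}.

Definition twice_derivable_at (f : R -> R) (x : R) : Prop :=
  (\forall y \near x, derivable f y 1) /\ derivable (derive1 f) x 1.

Definition frechet_case alpha F : Prop :=
  [/\ 0 < alpha, omega F = +oo%E &
      \forall x \near left_nbhs (omega F),
        C1_at (phi F) x /\ 0 < derive1 (phi F) x].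

Definition weibull_case alpha w F : Prop :=
  [/\ alpha < 0, omega F = w%:E &
      \forall x \near left_nbhs (omega F),
        C1_at (phi F) x /\ 0 < derive1 (phi F) x].

Definition gumbel_case alpha F : Prop :=
  alpha = 0 /\
  \forall x \near left_nbhs (omega F),
    twice_derivable_at (phi F) x /\ 0 < derive1 (phi F) x.

(* The domains dom_* of the functions h_alpha consist of the points at which the
   derivatives and quotients in their formulas exist, because derive1 and ^-1
   are total. *)
Definition h_frechet alpha F (x : R) : R := x * derive1 (phi F) x - alpha.

Definition dom_frechet F : set R :=
  [set x | [/\ 0 < x, supp F x & derivable (phi F) x 1]].

Definition h_weibull alpha w F (x : R) : R :=
  (w - x) * derive1 (phi F) x + alpha.

Definition dom_weibull w F : set R :=
  [set x | [/\ x < w, supp F x & derivable (phi F) x 1]].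

Definition h_gumbel F : R -> R := derive1 (fun y => (derive1 (phi F) y)^-1).

Definition dom_gumbel F : set R :=
  [set x | [/\ (x%:E < omega F)%E, supp F x, twice_derivable_at (phi F) x
             & derive1 (phi F) x != 0]].

Definition rate_bound F D h g : Prop :=
  [/\ forall x y, D x -> D y -> x <= y -> g y <= g x,
      g x @[x --> left_nbhs (omega F)] --> 0 &
      forall x, D x -> `|h x| <= g x].

Definition free_maxconv F G (x : R) : R := Num.max (F x + G x - 1) 0.

Definition free_maxpow F (n : nat) (x : R) : R :=
  Num.max (n%:R * F x - (n%:R - 1)) 0.

(* The density of x |-> F_n(a_n x + b_n), with the convention that it vanishes at
   the points mapped to or beyond omega F, where F may fail to be derivable. *)
Definition free_density F (a b : nat -> R) (n : nat) (x : R) : R :=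
  if ((a n * x + b n)%:E < omega F)%E then
    derive1 (fun t => free_maxpow F n (a n * t + b n)) x
  else 0.

Definition free_evd alpha (x : R) : R :=
  if 0 < alpha then
    if 1 < x then alpha * x `^ (- alpha - 1) else 0
  else if alpha < 0 then
    if -1 < x < 0 then - alpha * (- x) `^ (- alpha - 1) else 0
  else
    if 0 < x then expR (- x) else 0.

Definition sup_dist D (f g : R -> R) : \bar R :=
  ereal_sup [set `|f x - g x|%:E | x in D].

(* u_n <= O(c_n); u_n may be infinite for finitely many n. *)
Definition eventually_le_bigO (u : nat -> \bar R) (c : nat -> R) : Prop :=
  exists2 C : R, 0 < C & \forall n \near \oo, (u n <= (C * c n)%:E)%E.

Lemma free_maxpow1 F (x : R) : 0 <= F x -> free_maxpow F 1 x = F x.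
Proof. by move=> F0; rewrite /free_maxpow mul1r subrr subr0; exact/max_idPl. Qed.

Lemma free_maxpowS F (n : nat) (x : R) : F x <= 1 ->
  free_maxpow F n.+1 x = free_maxconv (free_maxpow F n) F x.
Proof.
move=> F1; rewrite /free_maxpow /free_maxconv -natr1.
have [|] := leP (n%:R * F x - (n%:R - 1)) 0 => nF.
  by rewrite !(max_idPr _) //; lra.
by congr Num.max; lra.
Qed.

Lemma free_densityE F (a b : nat -> R) (n : nat) (x : R) :
  (0 < n)%N -> 1 - n%:R^-1 < F (a n * x + b n) ->
  ((a n * x + b n)%:E < omega F)%E -> derivable F (a n * x + b n) 1 ->
  free_density F a b n x = n%:R * a n * derive1 F (a n * x + b n).
Proof.
move=> n0 Fx xw dF; rewrite /free_density xw.
set aff := fun t : R => a n * t + b n.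
have daff : is_derive x 1 aff (a n).
  have -> : aff = (a n \*: id) + cst (b n) by [].
  by apply: is_derive_eq; rewrite addr0 /GRing.scale /= mulr1.
have caff : {for x, continuous aff}.
  by apply/differentiable_continuous/derivable1_diffP; case: daff.
have cF : {for aff x, continuous F}.
  by apply/differentiable_continuous/derivable1_diffP.
have cFaff : {for x, continuous (F \o aff)} by exact: continuous_comp.
have ev : \forall t \near x,
    free_maxpow F n (aff t) = n%:R * (F \o aff) t - (n%:R - 1).
  have : \forall t \near x, 1 - n%:R^-1 < (F \o aff) t.
    by apply: (cvgr_gt _ cFaff).
  apply: filterS => t Ft; rewrite /free_maxpow; apply/max_idPl.
  have -> : n%:R * (F \o aff) t - (n%:R - 1) =
      n%:R * ((F \o aff) t - (1 - n%:R^-1)).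
    by rewrite !mulrBr mulr1 divff ?pnatr_eq0 -?lt0n.
  by rewrite mulr_ge0 // subr_ge0 ltW.
rewrite derive1E (near_eq_derive _ ev) ?oner_neq0 //.
have dFa : is_derive x 1 (F \o aff) (a n * derive1 F (aff x)).
  have dFx : is_derive (aff x) 1 F (derive1 F (aff x)).
    by apply: DeriveDef => //; rewrite derive1E.
  by rewrite mulrC; exact: is_derive1_comp.
have -> : (fun t => n%:R * (F \o aff) t - (n%:R - 1)) =
    (n%:R \*: (F \o aff)) - cst (n%:R - 1) by [].
rewrite deriveB ?deriveZ ?derive_cst ?subr0 ?derive_val //.
by rewrite /GRing.scale /= mulrA.
Qed.

Lemma free_density_right F (a b : nat -> R) (n : nat) (x : R) :
  (omega F <= (a n * x + b n)%:E)%E -> free_density F a b n x = 0.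
Proof. by rewrite /free_density ltNge => ->. Qed.

End von_mises.

(* Main.v *)
Require Import Defs.
From HB Require Import structures.
From mathcomp Require Import all_boot all_order all_algebra.
From mathcomp Require Import all_classical all_reals all_analysis.
From mathcomp Require Import ring lra.
Import Order.TTheory GRing.Theory Num.Theory.
Import numFieldNormedType.Exports.
Local Open Scope ring_scope.
Local Open Scope classical_set_scope.

(** Let [u] be the quantile with [F u = exp (-1/n)], let [y = a x + b >= u], and
    put [s = phi y - phi u].  Since [- ln F = exp (- phi)], the density is
    [a * phi' y * exp (- s) * F y], and the factor [F y] lies in [[1 - 1/n, 1]].

    In cases (i) and (ii), integrating the bound on [h_alpha] from [u] to [y]
    gives [| s - |alpha| l | <= g l] with [l = ln x], resp. [l = - ln (- x)], so
    the density is [(|alpha| + h) exp (- c l - E) F y] with [|E| <= g l] and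
    [c = alpha + 1], resp. [c = - alpha - 1]; such a perturbation of the exponent
    costs only [O(g)], uniformly in [l >= 0], because [c > 0].

    In case (iii), [1 / phi'] has logarithmic derivative [h] in the variable
    [phi], so [a * phi' y = exp (- E)] with [|E| <= g s], and the density is
    [O(1/n + g)]-close to [exp (- s)].  Moreover [exp (- s)] is, as a function of
    [x], almost a solution of [v' = - v], which forces it to be close to
    [exp (- x)].  Points beyond [omega F], where the density vanishes, are
    compared with the quantile of a much larger index. *)

(** * Calculus: integrating derivative bounds, perturbed exponentials, left neighborhoods *)

Section real_analysis.
Context {R : realType}.
Implicit Types (f L df dL : R -> R) (u v g : R).

Lemma is_derive_le f df u v : u <= v ->
  (forall y, u <= y <= v -> is_derive y 1 f (df y)) ->
  (forall y, u <= y <= v -> 0 <= df y) -> f u <= f v.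
Proof.
move=> uv hf df0; rewrite -subr_ge0.
have [||c cuv ->] := @MVT_segment R f df u v uv.
- by move=> y /subset_itv_oo_cc; rewrite in_itv/=; exact: hf.
- apply: derivable_within_continuous => y; rewrite in_itv/= => /hf yuv.
  exact: ex_derive.
- by rewrite mulr_ge0 ?subr_ge0// df0//; move: cuv; rewrite in_itv.
Qed.

(** The functions [g * L + f] and [g * L - f] both have a nonnegative derivative, hence are
    nondecreasing. This replaces integrating the bound on [df]. *)
Lemma dist_le_of_derive f df L dL g u v : u <= v ->
  (forall y, u <= y <= v -> is_derive y 1 f (df y)) ->
  (forall y, u <= y <= v -> is_derive y 1 L (dL y)) ->
  (forall y, u <= y <= v -> `|df y| <= g * dL y) ->
  `|f v - f u| <= g * (L v - L u).
Proof.
move=> uv hf hL fL.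
have D (y : R) : u <= y <= v ->
    is_derive y 1 (g *: L + f) (g * dL y + df y) /\
    is_derive y 1 (g *: L - f) (g * dL y - df y).
  move=> yuv; have ? := hf _ yuv; have ? := hL _ yuv.
  by split; apply: is_derive_eq.
have := @is_derive_le (g *: L + f) (fun y => g * dL y + df y) u v uv
  (fun y h => (D y h).1).
have := @is_derive_le (g *: L - f) (fun y => g * dL y - df y) u v uv
  (fun y h => (D y h).2).
rewrite /= !fctE /GRing.scale/= => h1 h2.
have {}h1 : g * L u - f u <= g * L v - f v.
  by apply: h1 => y /fL; rewrite ler_norml; lra.
have {}h2 : g * L u + f u <= g * L v + f v.
  by apply: h2 => y /fL; rewrite ler_norml; lra.
by rewrite ler_norml; lra.
Qed.

(** The error in the exponent may grow linearly in [s], but half of the decay rate [c] suffices to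
    absorb it: the difference is at most [g * s * expR (- (c / 2 * s))], which is bounded uniformly
    in [s]. *)
Lemma expR_perturb (c g s E : R) : 0 < c -> 0 <= g <= c / 2 -> 0 <= s ->
  `|E| <= g * s -> `|expR (- (c * s) - E) - expR (- (c * s))| <= 2 / c * g.
Proof.
move=> c0 /andP[g0 gc] s0 Es.
have gs0 : 0 <= g * s by rewrite mulr_ge0.
have -> : expR (- (c * s) - E) - expR (- (c * s)) =
    expR (- (c * s)) * (expR (- E) - 1) by rewrite expRD; ring.
rewrite normrM ger0_norm ?expR_ge0//.
(* For the lower side, [1 - expR (- E) <= E <= g * s <= expR (g * s) - 1]. *)
have E1 : `|expR (- E) - 1| <= expR (g * s) - 1.
  move: Es; rewrite !ler_norml => /andP[E1 E2].
  have : expR (- E) <= expR (g * s) by rewrite ler_expR; lra.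
  have : 1 - E <= expR (- E) by rewrite expR_ge1Dx.
  have : 1 + g * s <= expR (g * s) by rewrite expR_ge1Dx.
  by lra.
apply: (le_trans (ler_wpM2l (expR_ge0 _) E1)).
have -> : expR (- (c * s)) * (expR (g * s) - 1) =
    expR (- ((c - g) * s)) * (1 - expR (- (g * s))).
  by rewrite !mulrBr -!expRD !mulr1; congr (expR _ - expR _); ring.
have h1 : 1 - expR (- (g * s)) <= g * s.
  by have := expR_ge1Dx (- (g * s)); lra.
have h2 : expR (- ((c - g) * s)) <= expR (- (c / 2 * s)).
  by rewrite ler_expR lerN2 ler_wpM2r//; lra.
have h3 : 0 <= 1 - expR (- (g * s)) by rewrite subr_ge0 expR_le1 oppr_le0.
apply: (le_trans (ler_pM (expR_ge0 _) h3 h2 h1)).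
(* This bounds [s * expR (- (c / 2 * s))] by [2 / c], the constant of the lemma. *)
have h4 : c / 2 * s <= expR (c / 2 * s).
  by have := expR_ge1Dx (c / 2 * s); lra.
rewrite expRN mulrC ler_pdivrMr ?expR_gt0//.
have -> : g * s = 2 / c * g * (c / 2 * s) by field; rewrite gt_eqF.
by rewrite ler_wpM2l// mulr_ge0// divr_ge0// ltW.
Qed.

(** Replacing the three factors one at a time costs [g] for [h], [k * C * g] for [P] and [k * m] for
    [Fy]. *)
Lemma product_perturb (C k h P P0 Fy g m e : R) :
  0 <= k -> 0 <= C -> `|h| <= g ->
  0 <= P <= 1 -> 0 <= P0 <= 1 -> `|P - P0| <= C * g -> 0 <= 1 - Fy <= m ->
  0 <= Fy -> g <= e -> m <= e ->
  `|(k + h) * P * Fy - k * P0| <= (1 + k * C + k) * e.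
Proof.
move=> k0 C0 hg /andP[P0' P1] /andP[P00 P01] PP /andP[F1 Fm] F0 ge me.
have -> : (k + h) * P * Fy - k * P0 =
  h * (P * Fy) + k * (Fy * (P - P0)) - k * (P0 * (1 - Fy)) by ring.
have g0 : 0 <= g by exact: le_trans hg.
have PF : 0 <= P * Fy <= 1 by rewrite mulr_ge0//= mulr_ile1//; lra.
have h1 : `|h * (P * Fy)| <= g.
  rewrite normrM -[g]mulr1 ler_pM// ger0_norm; lra.
have h2 : `|k * (Fy * (P - P0))| <= k * (C * g).
  rewrite normrM ger0_norm// ler_wpM2l// normrM.
  rewrite -[leRHS]mul1r ler_pM// ger0_norm//; lra.
have h3 : `|k * (P0 * (1 - Fy))| <= k * m.
  rewrite normrM ger0_norm// ler_wpM2l// normrM !ger0_norm//.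
  by rewrite -[leRHS]mul1r ler_pM.
have h4 : k * (C * g) <= k * (C * e) by rewrite !ler_wpM2l.
have h5 : k * m <= k * e by rewrite ler_wpM2l.
apply: (le_trans (ler_normB _ _)).
have := ler_normD (h * (P * Fy)) (k * (Fy * (P - P0))).
lra.
Qed.

Lemma left_nbhs_tail (w : \bar R) (P : set R) : (-oo < w)%E ->
  left_nbhs w P ->
  exists2 M, (M%:E < w)%E & forall y, M < y -> (y%:E < w)%E -> P y.
Proof.
case: w => [r _|_|//] /=.
  move=> [e/= e0 he]; exists (r - e).
    by rewrite lte_fin gtrBl.
  move=> y My; rewrite lte_fin => yr; apply: he => //=.
  by rewrite ger0_norm ?subr_ge0 ?(ltW yr)//; lra.
move=> [M [_ hM]]; exists M; rewrite ?ltry// => y My _; exact: hM.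
Qed.

Lemma expRN_natV_lt1 (n : nat) : (0 < n)%N -> expR (- n%:R^-1) < 1 :> R.
Proof. by move=> n0; rewrite expR_lt1 oppr_lt0 invr_gt0 ltr0n. Qed.

Lemma sup_dist_le (D : set R) (f h : R -> R) (M : R) :
  (forall x, D x -> `|f x - h x| <= M) -> (sup_dist D f h <= M%:E)%E.
Proof.
by move=> fh; apply: ge_ereal_sup => _ [x /= /fh ? <-]; rewrite lee_fin.
Qed.

Lemma left_nbhs_itv (M : R) (w : \bar R) : (M%:E < w)%E ->
  \forall x \near left_nbhs w, M < x /\ (x%:E < w)%E.
Proof.
case: w => [r|_|//] /=.
  rewrite lte_fin => Mr; near=> x; rewrite lte_fin; split; near: x.
    exact: nbhs_left_gt.
  exact: nbhs_left_lt.
near=> x; rewrite ltry; split => //; near: x.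
by apply: nbhs_pinfty_gt; exact: num_real.
Unshelve. all: by end_near. Qed.

End real_analysis.

(** * Quantiles, the support, and the density expressed through [phi] *)

Section distribution.
Context {R : realType} (F : cumulativeBounded (0 : R) (1 : R)).
Implicit Types (u x y : R) (n : nat) (a b : nat -> R).

Let F_nd : {homo F : x y / x <= y}.
Proof. exact: cumulative_is_nondecreasing. Qed.

Lemma lt_omega x : (x%:E < omega F)%E -> F x < 1.
Proof.
move=> /ereal_sup_gt[_ [y /= Fy <-]]; rewrite lte_fin => xy.
by rewrite (le_lt_trans _ Fy)// F_nd// ltW.
Qed.

Lemma omega_ge x : F x < 1 -> (x%:E <= omega F)%E.
Proof. by move=> Fx; apply: ereal_sup_ubound; exists x. Qed.

Lemma lt_omegaW x y : F x < F y -> F y < 1 -> (x%:E < omega F)%E.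
Proof.
move=> xy /omega_ge; apply: lt_le_trans; rewrite lte_fin.
by rewrite ltNge; apply: contraTN xy => /F_nd; rewrite -leNgt.
Qed.

Lemma cumulative_lt_inv x y : F x < F y -> x < y.
Proof. by rewrite !ltNge; apply: contraNN; exact: F_nd. Qed.

(** For [M] below [omega F] one has [F M < 1], so [F (b n) >= 1 - n^-1] eventually exceeds [F M] and
    [b n] passes [M]. Moreover [b n] stays below [omega F], because [F (b n.+1)] is strictly larger
    than [F (b n)] and still less than 1. *)
Lemma quantile_cvg b :
  (\forall n \near \oo, F (b n) = expR (- n%:R^-1)) ->
  b @ \oo --> left_nbhs (omega F).
Proof.
move=> [N _ hN].
have {}hN m : (N <= m)%N -> F (b m) = expR (- m%:R^-1) by exact: hN.
have bo n : (N < n)%N -> ((b n)%:E < omega F)%E.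
  move=> Nn; have n0 : (0 < n)%N by exact: leq_ltn_trans Nn.
  have Nn1 : (N <= n.+1)%N by rewrite ltnW// ltnW.
  apply: (@lt_omegaW _ (b n.+1)); rewrite (hN _ Nn1) ?expRN_natV_lt1//.
  rewrite (hN _ (ltnW Nn)).
  by rewrite ltr_expR ltrN2 ltf_pV2 ?posrE ?ltr0n// ltr_nat.
move=> U /left_nbhs_tail[|M Mo hU].
  by apply: (lt_trans _ (bo N.+1 (ltnSn N))); rewrite ltNyr.
have FM := lt_omega _ Mo.
suff: \forall n \near \oo, U (b n) by [].
near=> n; apply: hU; last by apply: bo; near: n; exact: nbhs_infty_gt.
have n0 : (0 < n)%N by near: n; exact: nbhs_infty_gt.
apply: cumulative_lt_inv; rewrite hN; last first.
  by near: n; exact: nbhs_infty_ge.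
apply: lt_le_trans (expR_ge1Dx _).
suff : n%:R^-1 < 1 - F M by lra.
rewrite invf_plt ?posrE ?ltr0n ?subr_gt0//.
by near: n; exact: nbhs_infty_gtr.
Unshelve. all: by end_near. Qed.

(** Some [v > x] has [F v < 1], and by monotonicity [0 < F < 1] on the whole interval from [u] to
    [v]. *)
Lemma supp_tail u x : 0 < F u -> u < x -> (x%:E < omega F)%E -> supp F x.
Proof.
move=> Fu ux /ereal_sup_gt[_ [v /= Fv <-]]; rewrite lte_fin => xv.
have : \forall t \near x, t \in `]u, v[%R.
  by apply: near_in_itvoo; rewrite in_itv/= ux.
apply: filterS => t /=; rewrite in_itv/= => /andP[ut tv].
by rewrite (lt_le_trans Fu) ?F_nd 1?ltW//= (le_lt_trans _ Fv)// F_nd// ltW.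
Qed.

Lemma expRN_phi x : 0 < F x < 1 -> expR (- phi F x) = - ln (F x).
Proof. by move=> /ln_lt0 lnF; rewrite opprK lnK// posrE oppr_gt0. Qed.

(** On the open set [supp F] the identity [F = exp (- exp (- phi))] holds near [x], so derivability
    passes from [phi] back to [F]. *)
Lemma is_derive_of_phi x : supp F x -> derivable (phi F) x 1 ->
  is_derive x 1 F (F x * (- ln (F x)) * derive1 (phi F) x).
Proof.
move=> Fx dphi.
have nF : \forall t \near x, expR (- expR (- phi F t)) = F t.
  near=> t; have F01 : 0 < F t < 1 by near: t; exact: Fx.
  by rewrite expRN_phi// opprK lnK// posrE; case/andP: F01.
have F01 : 0 < F x < 1 by exact: nbhs_singleton Fx.
apply: (near_eq_is_derive nF).
have dp : is_derive x 1 (phi F) (derive1 (phi F) x).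
  by apply: DeriveDef => //; rewrite derive1E.
have d1 : is_derive x 1 (expR \o (- phi F))
    (expR (- phi F x) * - derive1 (phi F) x).
  exact: is_derive1_comp.
have d2 : is_derive x 1 (expR \o (- (expR \o (- phi F))))
    (expR (- expR (- phi F x)) * - (expR (- phi F x) * - derive1 (phi F) x)).
  exact: is_derive1_comp.
apply: (is_derive_eq d2).
by rewrite expRN_phi// opprK lnK ?posrE; [ring|case/andP: F01].
Unshelve. all: by end_near. Qed.

Lemma is_derive_phi x : derivable (phi F) x 1 ->
  is_derive x 1 (phi F) (derive1 (phi F) x).
Proof. by move=> dphi; apply: DeriveDef => //; rewrite derive1E. Qed.

Lemma expR_phi_quantile n u : (0 < n)%N -> F u = expR (- n%:R^-1) ->
  expR (phi F u) = n%:R.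
Proof.
move=> n0 Fu; rewrite -[phi F u]opprK expRN expRN_phi Fu.
  by rewrite expRK opprK invrK.
by rewrite expR_gt0 expRN_natV_lt1.
Qed.

(** In [n * a * F' y], the factor [n] is [expR (phi F u)] and [F' y] is
    [F y * expR (- phi F y) * phi' y]. *)
Lemma free_density_phi a b n u x : (0 < n)%N -> F u = expR (- n%:R^-1) ->
  u <= a n * x + b n -> ((a n * x + b n)%:E < omega F)%E ->
  supp F (a n * x + b n) -> derivable (phi F) (a n * x + b n) 1 ->
  free_density F a b n x =
    a n * derive1 (phi F) (a n * x + b n) *
    expR (- (phi F (a n * x + b n) - phi F u)) * F (a n * x + b n).
Proof.
set y := a n * x + b n => n0 Fu uy yw Fy dphi.
have dF := is_derive_of_phi _ Fy dphi.
rewrite free_densityE//; first last.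
(* Since [expR (- n^-1) > 1 - n^-1] strictly, even [y = u] lies where the truncated power is
   positive. *)
- apply: lt_le_trans (F_nd _ _ uy); rewrite Fu.
  by apply: expR_gt1Dx; rewrite oppr_eq0 invr_eq0 pnatr_eq0 -lt0n.
rewrite -/y derive1E derive_val opprB expRD (expR_phi_quantile _ _ n0 Fu).
by rewrite expRN_phi; [ring|exact: nbhs_singleton Fy].
Qed.

(** * Convergence rates in the two power-law cases *)

(** Common core of cases (i) and (ii), with [k] the absolute value of [alpha] and [L z] equal to
    [ln z], resp. [- ln (w - z)]. The prefactor [a n * dL y] is [expR (- s)], resp. [expR s], which
    gives [c = k + 1], resp. [c = k - 1]. *)
Lemma dist_free_density_power a b n u x (k c g : R) (L dL : R -> R) :
  let y := a n * x + b n in let s := L y - L u in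
  0 <= k -> 0 < c -> 0 <= g <= c / 2 -> (0 < n)%N ->
  F u = expR (- n%:R^-1) -> u <= y -> (y%:E < omega F)%E ->
  (forall z, u <= z <= y -> supp F z /\ derivable (phi F) z 1) ->
  (forall z, u <= z <= y -> is_derive z 1 L (dL z) /\ 0 < dL z) ->
  (forall z, u <= z <= y -> `|derive1 (phi F) z - k * dL z| <= g * dL z) ->
  a n * dL y * expR (- (k * s)) = expR (- (c * s)) ->
  `|free_density F a b n x - k * expR (- (c * s))| <=
    (1 + k * (2 / c) + k) * Num.max n%:R^-1 g.
Proof.
move=> y s k0 c0 gc n0 Fu uy yw dphi dL' hk aE.
have yuy : u <= y <= y by rewrite uy lexx.
have [g0 gc2] := andP gc.
have [Fy dy] := dphi _ yuy; have [_ dLy] := dL' _ yuy.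
have s0 : 0 <= s.
  rewrite subr_ge0; apply: (is_derive_le _ dL _ _ uy) => z /dL'[dLz dLz0].
    exact: dLz.
  exact: ltW.
pose E := phi F y - phi F u - k * s.
have Es : `|E| <= g * s.
  have -> : E = (phi F - k *: L) y - (phi F - k *: L) u.
    by rewrite /E /s !fctE /GRing.scale/=; ring.
  apply: (dist_le_of_derive _ (fun z => derive1 (phi F) z - k * dL z) _ dL
    _ _ _ uy).
  - move=> z uz; have [_ /is_derive_phi ?] := dphi _ uz; have [? _] := dL' _ uz.
    exact: is_derive_eq.
  - by move=> z /dL'[].
  - exact: hk.
(* In both applications this is the value of [h_alpha] at [y]. *)
pose h := derive1 (phi F) y / dL y - k.
have hg : `|h| <= g.
  rewrite -(ler_pM2r dLy) -[X in _ * X <= _](gtr0_norm dLy) -normrM.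
  by rewrite /h mulrBl divfK ?gt_eqF//; exact: hk.
have -> : free_density F a b n x = (k + h) * expR (- (c * s) - E) * F y.
  rewrite (free_density_phi _ _ _ u)// -/y.
  have -> : derive1 (phi F) y = (k + h) * dL y.
    by rewrite /h addrC subrK divfK ?gt_eqF.
  have -> : - (phi F y - phi F u) = - (k * s) - E by rewrite /E; ring.
  by rewrite !expRD -aE; ring.
have Fy1 : F y < 1 by exact: lt_omega.
have FyE : F u <= F y by exact: F_nd.
have Fu1 : 1 - n%:R^-1 <= F u by rewrite Fu expR_ge1Dx.
apply: (product_perturb _ _ _ _ _ _ g n%:R^-1) => //.
- by rewrite divr_ge0// ltW.
- rewrite expR_ge0 expR_le1/=.
  have : g * s <= c / 2 * s by rewrite ler_wpM2r.
  have : 0 <= c * s by rewrite mulr_ge0// ltW.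
  by move: Es; rewrite ler_norml; lra.
- by rewrite expR_ge0 expR_le1 oppr_le0 mulr_ge0// ltW.
- exact: expR_perturb.
- lra.
- by rewrite (le_trans _ FyE)// Fu expR_ge0.
- by rewrite le_max lexx orbT.
- by rewrite le_max lexx.
Qed.

(** Makes a property valid near [omega F] available at every point from the quantile [b n] up to
    [omega F], as the integration along that range requires. *)
Lemma quantile_tail b (P : set R) :
  (\forall n \near \oo, F (b n) = expR (- n%:R^-1)) ->
  left_nbhs (omega F) P ->
  \forall n \near \oo, [/\ (0 < n)%N, F (b n) = expR (- n%:R^-1),
    ((b n)%:E < omega F)%E &
    forall z, b n <= z -> (z%:E < omega F)%E -> supp F z /\ P z].
Proof.
move=> bF PF; have bw := quantile_cvg _ bF.
(* A fixed reference index: [F (b m) > 0] places every point between [b m] and [omega F] in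
   [supp F], and [b n] eventually passes [b m]. *)
have [m [m0 Fm]] : exists m, (0 < m)%N /\ F (b m) = expR (- m%:R^-1).
  near \oo => m; exists m; split; near: m => //; exact: nbhs_infty_gt.
have Fm1 : F (b m) < 1 by rewrite Fm expRN_natV_lt1.
have w0 : (-oo < omega F)%E.
  by apply: lt_le_trans (omega_ge _ Fm1); rewrite ltNyr.
have bmw : ((b m)%:E < omega F)%E.
  near \oo => p; apply: (lt_omegaW _ (b p)).
    have -> : F (b p) = expR (- p%:R^-1) by near: p.
    rewrite Fm ltr_expR ltrN2 ltf_pV2 ?posrE ?ltr0n ?ltr_nat//.
      by near: p; exact: nbhs_infty_gt.
    by near: p; exact: nbhs_infty_gt.
  have -> : F (b p) = expR (- p%:R^-1) by near: p.
  by apply: expRN_natV_lt1; near: p; exact: nbhs_infty_gt.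
have [M Mw hM] := left_nbhs_tail _ _ w0 PF.
have Uw : \forall n \near \oo, Num.max M (b m) < b n /\ ((b n)%:E < omega F)%E.
  apply: (bw _ (left_nbhs_itv (Num.max M (b m)) _ _)).
  by rewrite EFin_max gt_max Mw.
near=> n.
have [] : Num.max M (b m) < b n /\ ((b n)%:E < omega F)%E by near: n.
rewrite gt_max => /andP[Mn mn] nw; split => //.
- by near: n; exact: nbhs_infty_gt.
- by near: n.
- move=> z nz zw; split; last by apply: hM => //; exact: lt_le_trans nz.
  apply: (supp_tail (b m)) => //; first by rewrite Fm expR_gt0.
  exact: lt_le_trans nz.
Unshelve. all: by end_near. Qed.

Lemma frechet_rate (alpha : R) (g : R -> R) a : frechet_case alpha F ->
  rate_bound F (dom_frechet F) (h_frechet alpha F) g ->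
  (\forall n \near \oo, 0 < a n /\ F (a n) = expR (- n%:R^-1)) ->
  eventually_le_bigO
    (fun n => sup_dist [set x | 1 < x]
                (free_density F a (fun=> 0) n) (free_evd alpha))
    (fun n => Num.max n%:R^-1 (g (a n))).
Proof.
move=> [alpha0 wy C1] [g_ni g0 hg] aF.
have aF2 : \forall n \near \oo, F (a n) = expR (- n%:R^-1).
  by apply: filterS aF => n [].
have c0 : 0 < alpha + 1 by lra.
have c20 : 0 < (alpha + 1) / 2 by lra.
(* The smallness [g <= c / 2] demanded by [expR_perturb], with [c = alpha + 1]. *)
have gs : \forall x \near left_nbhs (omega F), g x < (alpha + 1) / 2.
  exact: (cvgr_lt _ g0).
have tl := quantile_tail _ _ aF2 (filterI C1 gs).
exists (1 + alpha * (2 / (alpha + 1)) + alpha).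
  have : 0 < alpha * (2 / (alpha + 1)) by rewrite mulr_gt0// divr_gt0.
  lra.
near=> n; apply: sup_dist_le => x /= x1.
have [an0 _] : 0 < a n /\ F (a n) = expR (- n%:R^-1) by near: n.
have [n0 Fan anw T] : [/\ (0 < n)%N, F (a n) = expR (- n%:R^-1),
    ((a n)%:E < omega F)%E &
    forall z, a n <= z -> (z%:E < omega F)%E -> supp F z /\
    ((C1_at (phi F) z /\ 0 < derive1 (phi F) z) /\ g z < (alpha + 1) / 2)].
  by near: n; exact: tl.
have Dz z : a n <= z -> dom_frechet F z.
  move=> anz; have [|? [[[? _] _] _]] := T _ anz; first by rewrite wy ltry.
  by split => //; exact: lt_le_trans anz.
have x0 : 0 < x by exact: lt_trans x1.
have [_ [_ gan]] := T _ (lexx _) anw.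
have gan0 : 0 <= g (a n) := le_trans (normr_ge0 _) (hg _ (Dz _ (lexx _))).
have y_ge : a n <= a n * x + 0 by rewrite addr0 ler_peMr// ltW.
have sE : ln (a n * x + 0) - ln (a n) = ln x.
  by rewrite addr0 lnM ?posrE// addrC addKr.
have evdE : free_evd alpha x =
    alpha * expR (- ((alpha + 1) * (ln (a n * x + 0) - ln (a n)))).
  by rewrite sE /free_evd alpha0 x1 /powR gt_eqF// -mulNr opprD.
rewrite evdE.
apply: (dist_free_density_power a (fun=> 0) n (a n) x alpha (alpha + 1)
  (g (a n)) (@ln R) GRing.inv) => //.
- exact: ltW.
- by rewrite gan0 ltW.
- by rewrite wy ltry.
- by move=> z /andP[/Dz[]].
- move=> z /andP[anz _]; have z0 : 0 < z by exact: lt_le_trans anz.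
  by split; [exact: is_derive1_ln|rewrite invr_gt0].
- move=> z /andP[anz _]; have z0 : 0 < z by exact: lt_le_trans anz.
  have Ddz := Dz _ anz.
  rewrite ler_pdivlMr// -[X in _ * X](gtr0_norm z0) -normrM.
  have -> : (derive1 (phi F) z - alpha / z) * z = h_frechet alpha F z.
    by rewrite /h_frechet; field; rewrite gt_eqF.
  exact: le_trans (hg _ Ddz) (g_ni _ _ (Dz _ (lexx _)) Ddz anz).
- have -> : a n / (a n * x + 0) = expR (- ln x).
    by rewrite addr0 expRN lnK ?posrE// invfM mulrA divff ?mul1r ?gt_eqF.
  by rewrite sE -expRD; congr expR; ring.
Unshelve. all: by end_near. Qed.

(** Here [s = - ln (- x)] and the decay rate is [c = - alpha - 1], which is positive exactly when
    [alpha < -1]. *)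
Lemma weibull_rate (alpha w : R) (g : R -> R) a : weibull_case alpha w F ->
  rate_bound F (dom_weibull w F) (h_weibull alpha w F) g -> alpha < -1 ->
  (\forall n \near \oo, 0 < a n /\ F (w - a n) = expR (- n%:R^-1)) ->
  eventually_le_bigO
    (fun n => sup_dist [set x | -1 < x < 0]
                (free_density F a (fun=> w) n) (free_evd alpha))
    (fun n => Num.max n%:R^-1 (g (w - a n))).
Proof.
move=> [alpha0 wE C1] [g_ni g0 hg] alphaN1 aF.
have aF2 : \forall n \near \oo, F (w - a n) = expR (- n%:R^-1).
  by apply: filterS aF => n [].
have c0 : 0 < - alpha - 1 by lra.
have c20 : 0 < (- alpha - 1) / 2 by lra.
have gs : \forall x \near left_nbhs (omega F), g x < (- alpha - 1) / 2.
  exact: (cvgr_lt _ g0).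
have tl := quantile_tail (fun n => w - a n) _ aF2 (filterI C1 gs).
exists (1 + - alpha * (2 / (- alpha - 1)) + - alpha).
  have : 0 < - alpha * (2 / (- alpha - 1)).
    by rewrite mulr_gt0 ?divr_gt0 ?oppr_gt0.
  lra.
near=> n; apply: sup_dist_le => x /= /andP[xN1 x0].
have [an0 _] : 0 < a n /\ F (w - a n) = expR (- n%:R^-1) by near: n.
have [n0 Fan anw T] : [/\ (0 < n)%N, F (w - a n) = expR (- n%:R^-1),
    ((w - a n)%:E < omega F)%E &
    forall z, w - a n <= z -> (z%:E < omega F)%E -> supp F z /\
    ((C1_at (phi F) z /\ 0 < derive1 (phi F) z) /\ g z < (- alpha - 1) / 2)].
  by near: n; exact: tl.
set u := w - a n in Fan anw T *.
have Dz z : u <= z -> z < w -> dom_weibull w F z.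
  by move=> uz zw; have [|? [[[? _] _] _]] := T _ uz; rewrite ?wE ?lte_fin.
have uw : u < w by rewrite gtrBl.
have [_ [_ gu]] := T _ (lexx _) anw.
have gu0 : 0 <= g u := le_trans (normr_ge0 _) (hg _ (Dz _ (lexx _) uw)).
have yw : a n * x + w < w by rewrite gtrDr pmulr_rlt0.
have uy : u <= a n * x + w.
  have : a n * -1 <= a n * x by rewrite ler_wpM2l// ltW.
  by rewrite /u; lra.
have Nx0 : 0 < - x by rewrite oppr_gt0.
pose L (z : R) := - ln (w - z).
have sE : L (a n * x + w) - L u = - ln (- x).
  rewrite /L /u; have -> : w - (a n * x + w) = a n * (- x) by ring.
  have -> : w - (w - a n) = a n by ring.
  by rewrite lnM ?posrE//; ring.
have evdE : free_evd alpha x =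
    - alpha * expR (- ((- alpha - 1) * (L (a n * x + w) - L u))).
  rewrite sE /free_evd ltNge ltW//= alpha0 xN1 x0/= /powR gt_eqF//.
  by rewrite mulrN opprK.
rewrite evdE.
apply: (dist_free_density_power a (fun=> w) n u x (- alpha) (- alpha - 1)
  (g u) L (fun z => (w - z)^-1)) => //.
- by rewrite oppr_ge0 ltW.
- by rewrite gu0 ltW.
- by rewrite wE lte_fin.
- by move=> z /andP[uz zy]; have [] := Dz _ uz (le_lt_trans zy yw).
- move=> z /andP[uz zy].
  have z0 : 0 < w - z by rewrite subr_gt0 (le_lt_trans zy).
  split; last by rewrite invr_gt0.
  have dw : is_derive z 1 (fun t : R => w - t) (-1).
    have -> : (fun t : R => w - t) = cst w - id by [].
    by apply: is_derive_eq; rewrite sub0r.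
  have dl : is_derive z 1 (@ln R \o (fun t : R => w - t)) ((w - z)^-1 * -1).
    exact: (@is_derive1_comp _ (@ln R) (fun t => w - t) _ _ _
      (is_derive1_ln z0) dw).
  have -> : L = - (@ln R \o (fun t : R => w - t)) by [].
  by apply: is_derive_eq; rewrite mulrN1 opprK.
- move=> z /andP[uz zy]; have zw := le_lt_trans zy yw.
  have z0 : 0 < w - z by rewrite subr_gt0.
  have Ddz := Dz _ uz zw.
  rewrite ler_pdivlMr// -[X in _ * X](gtr0_norm z0) -normrM.
  have -> : (derive1 (phi F) z - - alpha / (w - z)) * (w - z) =
      h_weibull alpha w F z.
    by rewrite /h_weibull; field; rewrite gt_eqF.
  exact: le_trans (hg _ Ddz) (g_ni _ _ (Dz _ (lexx _) uw) Ddz uz).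
- have -> : a n / (w - (a n * x + w)) = expR (- ln (- x)).
    rewrite expRN lnK ?posrE//; field.
    by rewrite lt_eqF//= gt_eqF// subr_gt0.
  by rewrite sE -expRD; congr expR; ring.
Unshelve. all: by end_near. Qed.

(** * Convergence rate in the Gumbel case *)

(** A single number [g] bounds the error on the whole segment: since the bounding function is
    non-increasing, its value at [u] serves. *)
Definition gumbel_tail u y (g : R) := forall z, u <= z <= y ->
  [/\ twice_derivable_at (phi F) z, 0 < derive1 (phi F) z
    & `|h_gumbel F z| <= g].

Lemma gumbel_tailW u y z (g : R) : z <= y ->
  gumbel_tail u y g -> gumbel_tail u z g.
Proof.
by move=> zy T t /andP[ut tz]; apply: T; rewrite ut (le_trans tz).
Qed.

Lemma gumbel_tail_derive u y (g : R) : gumbel_tail u y g ->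
  forall z, u <= z <= y -> is_derive z 1 (phi F) (derive1 (phi F) z).
Proof. by move=> T z /T[[/nbhs_singleton /is_derive_phi]]. Qed.

Lemma phi_gumbel_tail u y (g : R) : u <= y -> gumbel_tail u y g ->
  phi F u <= phi F y.
Proof.
move=> uy T; apply: (is_derive_le _ (derive1 (phi F))) => //.
  exact: gumbel_tail_derive T.
by move=> z /T[_ /ltW].
Qed.

(* In the variable [phi], the logarithm of [1 / phi'] has derivative [h]. *)
Lemma dist_ln_dphi u y (g : R) : u <= y -> gumbel_tail u y g ->
  `|ln (derive1 (phi F) y) - ln (derive1 (phi F) u)| <= g * (phi F y - phi F u).
Proof.
move=> uy T; pose f z := (derive1 (phi F) z)^-1.
have df z : u <= z <= y ->
    is_derive z 1 (@ln R \o f) (derive1 (phi F) z * h_gumbel F z).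
  move=> /T[[_ d2] p0 _].
  have f0 : 0 < f z by rewrite invr_gt0.
  have dfz : is_derive z 1 f (h_gumbel F z).
    apply: DeriveDef; last by rewrite /h_gumbel derive1E.
    by apply: derivableV => //; rewrite gt_eqF.
  have := @is_derive1_comp _ (@ln R) f z _ _ (is_derive1_ln f0) dfz.
  by rewrite /f invrK.
have fE z : u <= z <= y -> ln (f z) = - ln (derive1 (phi F) z).
  by move=> /T[_ p0 _]; rewrite lnV.
have := dist_le_of_derive (@ln R \o f) _ (phi F) (derive1 (phi F)) g u y uy df
  (gumbel_tail_derive _ _ _ T).
rewrite /= !fE ?lexx ?uy// -opprD normrN; apply => z /T[_ p0 hz].
by rewrite normrM gtr0_norm// mulrC ler_wpM2r// ltW.
Qed.

(** The ratio of the derivatives is [expR (- E)] with [E] of size at most [g * s], so [expR_perturb]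
    applies with [c = 1]. As [a n] will be [1 / phi' u], the first product is the density without
    its factor [F y]. *)
Lemma dist_dphi_ratio u y (g : R) : 0 <= g <= 1 / 2 -> u <= y ->
  gumbel_tail u y g ->
  `|derive1 (phi F) y / derive1 (phi F) u * expR (- (phi F y - phi F u))
    - expR (- (phi F y - phi F u))| <= 2 * g.
Proof.
move=> g12 uy T; have s0 : 0 <= phi F y - phi F u.
  by rewrite subr_ge0; exact: phi_gumbel_tail T.
have [_ py _] : [/\ twice_derivable_at (phi F) y, 0 < derive1 (phi F) y
    & `|h_gumbel F y| <= g] by apply: T; rewrite uy lexx.
have [_ pu _] : [/\ twice_derivable_at (phi F) u, 0 < derive1 (phi F) u
    & `|h_gumbel F u| <= g] by apply: T; rewrite uy lexx.
have lnr : `|ln (derive1 (phi F) u) - ln (derive1 (phi F) y)| <=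
    g * (phi F y - phi F u) by rewrite distrC; exact: dist_ln_dphi.
have := expR_perturb 1 g _ _ ltr01 g12 s0 lnr.
have -> : - (1 * (phi F y - phi F u)) -
    (ln (derive1 (phi F) u) - ln (derive1 (phi F) y)) =
  ln (derive1 (phi F) y) - ln (derive1 (phi F) u) - (phi F y - phi F u) by ring.
by rewrite mul1r divr1 expRD [X in X * _]expRD [expR (- ln _)]expRN !lnK.
Qed.

(** An integrating factor argument. With [v = expR (- (phi F z - phi F u))], [p = phi' u] and
    [A z = (z - u) * p], the product [K = expR A * v] has derivative
    [expR A * p * (v - phi' / p * v)], of size at most [2 * g] times the derivative of [expR A].
    Integrating from [u], where [K = 1], and dividing by [expR (A y)] gives the bound. *)
Lemma dist_expR_phi u y (g : R) : 0 <= g <= 1 / 2 -> u <= y ->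
  gumbel_tail u y g ->
  `|expR (- (phi F y - phi F u)) - expR (- ((y - u) * derive1 (phi F) u))|
    <= 2 * g.
Proof.
move=> g12 uy T; set p : R := derive1 (phi F) u.
have p0 : 0 < p by have [] := T u; rewrite ?lexx ?uy.
pose A (z : R) : R := (z - u) * p.
have dA (z : R) : is_derive z 1 A p.
  have -> : A = p *: (id - cst u) by apply/funext => t; rewrite /A mulrC.
  by apply: is_derive_eq; rewrite subr0 /GRing.scale/= mulr1.
pose K := expR \o (A - phi F + cst (phi F u)).
have dK z : u <= z <= y -> is_derive z 1 K (K z * (p - derive1 (phi F) z)).
  move=> /(gumbel_tail_derive _ _ _ T) ?; apply: is_derive1_comp.
  by apply: is_derive_eq; rewrite subr0.
have dT (z : R) : is_derive z 1 (expR \o A) (expR (A z) * p).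
  exact: is_derive1_comp.
have Ky z : K z = expR (A z) * expR (- (phi F z - phi F u)).
  by rewrite /K /= !fctE -expRD; congr expR; rewrite /cst; ring.
have := dist_le_of_derive K _ (expR \o A) _ (2 * g) u y uy dK (fun z _ => dT z).
have Au : A u = 0 by rewrite /A subrr mul0r.
rewrite !Ky /= Au subrr oppr0 expR0 mulr1 => KE.
have {}KE : `|expR (A y) * expR (- (phi F y - phi F u)) - 1| <=
    2 * g * (expR (A y) - 1).
  apply: KE => z /[dup] /andP[uz zy] uzy.
  have -> : K z * (p - derive1 (phi F) z) = - (expR (A z) * p *
      (derive1 (phi F) z / p * expR (- (phi F z - phi F u))
      - expR (- (phi F z - phi F u)))).
    by rewrite Ky; field; rewrite gt_eqF.
  rewrite normrN normrM gtr0_norm ?mulr_gt0 ?expR_gt0// [leRHS]mulrC.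
  rewrite ler_wpM2l//; first by rewrite mulr_ge0 ?expR_ge0// ltW.
  by apply: dist_dphi_ratio => //; exact: gumbel_tailW T.
have A0 := expR_gt0 (A y).
rewrite -(ler_pM2l A0) -{1}(gtr0_norm A0) -normrM mulrBr -[(y - u) * p]/(A y).
rewrite -[X in _ - X]expRD subrr expR0 (le_trans KE)//.
have [g0 _] := andP g12.
by rewrite [leRHS]mulrC ler_wpM2l ?mulr_ge0// gerBl.
Qed.

Lemma gumbel_rate (alpha : R) (g : R -> R) a b : gumbel_case alpha F ->
  rate_bound F (dom_gumbel F) (h_gumbel F) g ->
  (\forall n \near \oo, F (b n) = expR (- n%:R^-1) /\
                        a n = F (b n) / (n%:R * derive1 F (b n))) ->
  eventually_le_bigO
    (fun n => sup_dist [set x | 0 < x] (free_density F a b n) (free_evd alpha))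
    (fun n => Num.max n%:R^-1 (g (b n))).
Proof.
move=> [-> d2] [g_ni g0 hg] abF.
have bF : \forall n \near \oo, F (b n) = expR (- n%:R^-1).
  by apply: filterS abF => n [].
have gs : \forall x \near left_nbhs (omega F), g x < 1 / 2.
  by apply: (cvgr_lt _ g0); rewrite divr_gt0.
(* The threshold [N] is kept explicit because the tail property is used at a second index [m] as
   well. *)
have [N _ tl] := quantile_tail _ _ bF (filterI d2 gs).
(* Twice [2 * g] from the two preceding estimates, plus [n^-1] from the factor [F y]. *)
exists 5 => //.
near=> n.
have Nn : (N <= n)%N by near: n; exact: nbhs_infty_ge.
have [_ aE] : F (b n) = expR (- n%:R^-1) /\
  a n = F (b n) / (n%:R * derive1 F (b n)) by near: n.
have [n0 Fu uw T] := tl _ Nn.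
set u := b n in aE Fu uw T *.
have n0R : 0 < n%:R :> R by rewrite ltr0n.
have Dz z : u <= z -> (z%:E < omega F)%E -> dom_gumbel F z.
  move=> uz zw; have [? [[? p0] _]] := T _ uz zw.
  by split => //; rewrite gt_eqF.
have [Fsu [[d2u pu] gu]] := T _ (lexx _) uw.
have gu0 : 0 <= g u := le_trans (normr_ge0 _) (hg _ (Dz _ (lexx _) uw)).
have g12 : 0 <= g u <= 1 / 2 by rewrite gu0 ltW.
have tail z : (z%:E < omega F)%E -> gumbel_tail u z (g u).
  move=> zw t /andP[ut tz]; have tw : (t%:E < omega F)%E.
    by apply: le_lt_trans zw; rewrite lee_fin.
  have [_ [[? ?] _]] := T _ ut tw; split => //.
  have Dt := Dz _ ut tw.
  exact: le_trans (hg _ Dt) (g_ni _ _ (Dz _ (lexx _) uw) Dt ut).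
(* From [F' u = F u * (- ln (F u)) * phi' u] and [- ln (F u) = n^-1]. *)
have {}aE : a n = (derive1 (phi F) u)^-1.
  have dpu : derivable (phi F) u 1 by have [/nbhs_singleton] := d2u.
  have dF := is_derive_of_phi _ Fsu dpu.
  rewrite aE [derive1 F u]derive1E derive_val Fu expRK opprK; field.
  by rewrite !gt_eqF ?expR_gt0.
have ap : 0 < a n by rewrite aE invr_gt0.
have n1M : n%:R^-1 <= Num.max n%:R^-1 (g u) by rewrite le_max lexx.
have gM : g u <= Num.max n%:R^-1 (g u) by rewrite le_max lexx orbT.
move: (Num.max _ _) n1M gM => M n1M gM.
apply: sup_dist_le => x /= x0.
rewrite /free_evd ltxx x0.
have uy : u <= a n * x + u by rewrite lerDr mulr_ge0 ?ltW.
have [yw|yw] := ltP ((a n * x + u)%:E) (omega F); last first.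
  rewrite free_density_right// sub0r normrN ger0_norm ?expR_ge0//.
  (* The quantile [b m] lies below [omega F], hence below [a n * x + u], so [expR (- x)] is at most
     its counterpart at [b m]. That is within [2 * g u] of [n / m = 1 / n.+1], and this choice of
     [m] makes the latter smaller than [n^-1]. *)
  set m := (n * n.+1)%N.
  have nm : (n < m)%N by rewrite ltn_Pmulr.
  have [m0 Fm mw _] := tl m (leq_trans Nn (ltnW nm)).
  have um : u <= b m.
    apply: ltW; apply: (cumulative_lt_inv u);
    rewrite Fu Fm ltr_expR ltrN2 ltf_pV2 ?posrE ?ltr0n//.
    by rewrite ltr_nat.
  have /ler_normlP[+ _] := dist_expR_phi _ _ _ g12 um (tail _ mw).
  have -> : expR (- (phi F (b m) - phi F u)) = n.+1%:R^-1.
    rewrite opprB expRD (expR_phi_quantile _ _ n0 Fu) expRN.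
    rewrite (expR_phi_quantile _ _ m0 Fm) natrM invfM mulrA divff ?mul1r//.
    by rewrite gt_eqF.
  have : n.+1%:R^-1 <= n%:R^-1 :> R.
    by rewrite lef_pV2 ?posrE ?ltr0n// ler_nat.
  have : expR (- x) <= expR (- ((b m - u) * derive1 (phi F) u)).
    rewrite ler_expR lerN2 -ler_pdivlMr// mulrC -aE lerBlDr.
    by rewrite -lee_fin; apply: le_trans yw; exact: ltW.
  by move: (n.+1%:R^-1 : R) (expR (- (_ * _))) => r1 r2; lra.
have yT := tail _ yw.
have [Fsy [[/proj1/nbhs_singleton dy _] _]] := T _ uy yw.
rewrite (free_density_phi _ _ _ u)// -/u.
set y := a n * x + u in uy yw yT Fsy dy *.
have Fy1 : F y < 1 by exact: lt_omega.
have Fy0 : 0 < F y by have /nbhs_singleton/andP[] := Fsy.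
have Fyn : 1 - F y <= n%:R^-1.
  have : F u <= F y by exact: F_nd.
  by have := expR_ge1Dx (- n%:R^-1 : R); rewrite Fu; lra.
have := dist_dphi_ratio _ _ _ g12 uy yT.
have := dist_expR_phi _ _ _ g12 uy yT.
have -> : (y - u) * derive1 (phi F) u = x.
  by rewrite /y aE addrK mulrAC mulVf ?mul1r// gt_eqF.
rewrite [_ / derive1 (phi F) u]mulrC -aE.
(* [q] is the density without its factor [F y]; it is compared with [expR (- x)] through [e]. *)
set q := a n * _ * _; set e := expR (- (_ - _)) => eE qE.
have qx : `|q - expR (- x)| <= 4 * g u.
  by have := ler_distD e q (expR (- x)); lra.
have -> : q * F y - expR (- x) =
    (q - expR (- x)) * F y - expR (- x) * (1 - F y).
  by ring.
apply: (le_trans (ler_normB _ _)); rewrite !normrM.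
have h1 : `|q - expR (- x)| * `|F y| <= 4 * g u.
  by rewrite -[leRHS]mulr1 ler_pM// gtr0_norm// ltW.
have h2 : `|expR (- x)| * `|1 - F y| <= n%:R^-1.
  rewrite -[leRHS]mul1r ler_pM//.
    by rewrite ger0_norm ?expR_ge0// expR_le1 oppr_le0 ltW.
  by rewrite ger0_norm// subr_ge0 ltW.
by lra.
Unshelve. all: by end_near. Qed.

End distribution.

(** * The counterexample to uniform convergence for [-1/2 < alpha < 0] *)

Lemma uniform_near_dist {R : realType} (D : set R) (f : nat -> R -> R)
  (l : R -> R) (e : R) : 0 < e -> {uniform D, f @ \oo --> l} ->
  \forall n \near \oo, forall x, D x -> `|l x - f n x| < e.
Proof.
move=> e0 fl; apply: (fl [set h | forall x, D x -> `|l x - h x| < e]).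
apply/uniform_nbhs; exists [set xy | ball xy.1 e xy.2]; split => //.
exact: (entourage_ball _ (PosNum e0)).
Qed.

(** The parameter [k] stands for [- alpha]; bundling its positivity lets the structure of a
    distribution function be attached to [weibull_cdf k]. *)
Definition weibull_cdf {R : realType} (k : {posnum R}) (x : R) : R :=
  if x < 0 then expR (- (- x) `^ k%:num) else 1.

Section weibull_cdf.
Context {R : realType} (k : {posnum R}).
Implicit Types x : R.

Let weibull_cdf_nd : nondecreasing (weibull_cdf k).
Proof.
move=> x y xy; rewrite /weibull_cdf; case: (ltP y 0) => y0.
  rewrite (le_lt_trans xy y0) ler_expR lerN2.
  apply: ge0_ler_powR; rewrite ?nnegrE ?oppr_ge0 ?lerN2 ?(ltW y0)//.
  by rewrite (le_trans xy) ?ltW.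
by case: ifP => // _; rewrite expR_le1 oppr_le0 powR_ge0.
Qed.

Let weibull_cdf_rc : right_continuous (weibull_cdf k).
Proof.
move=> x; have [x0|x0] := ltP x 0.
  apply: cvg_at_right_filter.
  suff : derivable (weibull_cdf k) x 1.
    by move=> /derivable1_diffP/differentiable_continuous.
  have nx : 0 < - x by rewrite oppr_gt0.
  have d1 : is_derive x 1 (@powR R ^~ k%:num \o -%R)
      (k%:num * (- x) `^ (k%:num - 1) * -1).
    exact: (@is_derive1_comp _ _ (-%R : R -> R) x _ _
      (is_derive1_powR k%:num nx)).
  have d2 : is_derive x 1 (expR \o (- (@powR R ^~ k%:num \o -%R)))
      (expR (- (- x) `^ k%:num) * - (k%:num * (- x) `^ (k%:num - 1) * -1)).
    exact: is_derive1_comp.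
  suff nF : \forall t \near x,
      (expR \o (- (@powR R ^~ k%:num \o -%R))) t = weibull_cdf k t.
    by have ? := near_eq_is_derive nF d2; exact: ex_derive.
  near=> t; rewrite /weibull_cdf ifT//; near: t; exact: lt_nbhsl.
apply: cvg_near_cst; near=> t.
have xt : x < t by near: t; exact: nbhs_right_gt.
by rewrite /weibull_cdf !ltNge x0 (le_trans x0)// ltW.
Unshelve. all: by end_near. Qed.

HB.instance Definition _ := isCumulative.Build _ _ _ (weibull_cdf k)
  weibull_cdf_nd weibull_cdf_rc.

Let weibull_cdfNy : weibull_cdf k x @[x --> -oo] --> (0 : R).
Proof.
apply/cvgr0Pnorm_lt => e e0; near=> x.
(* Chosen so that the power [k] of [r] is [e^-1]; left of [- r] the function is then at most
   [expR (- e^-1)], which is less than [e]. *)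
pose r := (e^-1) `^ (k%:num^-1).
have xr : x < - r by near: x; apply: nbhs_ninfty_lt; exact: num_real.
have r0 : 0 < r by rewrite powR_gt0 ?invr_gt0.
rewrite /weibull_cdf ifT ?(lt_trans xr) ?oppr_lt0// ger0_norm ?expR_ge0//.
have h : e^-1 <= (- x) `^ k%:num.
  have -> : e^-1 = r `^ k%:num.
    by rewrite -powRrM mulVf ?gt_eqF// powRr1// invr_ge0 ltW.
  by apply: ge0_ler_powR; rewrite ?nnegrE ?ltW//; lra.
apply: (@le_lt_trans _ _ (expR (- e^-1))); first by rewrite ler_expR lerN2.
rewrite expRN invf_plt ?posrE ?expR_gt0//.
by apply: le_lt_trans (expR_gt1Dx _); rewrite ?gt_eqF ?invr_gt0// lerDr.
Unshelve. all: by end_near. Qed.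

Let weibull_cdfy : weibull_cdf k x @[x --> +oo] --> (1 : R).
Proof.
apply: cvg_near_cst; near=> x; rewrite /weibull_cdf ltNge ifF//.
by apply/negbF; near: x; apply: nbhs_pinfty_ge; exact: num_real.
Unshelve. all: by end_near. Qed.

HB.instance Definition _ := isCumulativeBounded.Build R 0 1 (weibull_cdf k)
  weibull_cdfNy weibull_cdfy.

Lemma weibull_cdf_lt0 x : x < 0 -> weibull_cdf k x = expR (- (- x) `^ k%:num).
Proof. by rewrite /weibull_cdf => ->. Qed.

Lemma weibull_cdf_itv x : x < 0 -> 0 < weibull_cdf k x < 1.
Proof.
move=> x0; rewrite weibull_cdf_lt0// expR_gt0 expR_lt1 oppr_lt0.
by rewrite powR_gt0// oppr_gt0.
Qed.

Lemma supp_weibull_cdf x : x < 0 -> supp (weibull_cdf k) x.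
Proof.
move=> x0; have : \forall t \near x, t < 0 by exact: lt_nbhsl.
by apply: filterS => t; exact: weibull_cdf_itv.
Qed.

Lemma omega_weibull_cdf : omega (weibull_cdf k) = 0%E.
Proof.
apply/eqP; rewrite eq_le; apply/andP; split.
  apply: ge_ereal_sup => _ [x /= Fx <-]; rewrite lee_fin leNgt.
  by apply: contraTN Fx => x0; rewrite /weibull_cdf (le_gtF (ltW x0)) ltxx.
apply/lee_subgt0Pr => e e0; rewrite sub0e -EFinN.
apply: omega_ge; have [|_] := andP (weibull_cdf_itv (- e) _) => //.
by rewrite oppr_lt0.
Qed.

Lemma phi_weibull_cdf x : x < 0 ->
  phi (weibull_cdf k) x = - (k%:num * ln (- x)).
Proof. by move=> x0; rewrite /phi weibull_cdf_lt0// expRK opprK ln_powR. Qed.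

(** Thus [(0 - x) * phi' x] is exactly [k], which is why [h_alpha] vanishes identically. *)
Lemma is_derive_phi_weibull_cdf x : x < 0 ->
  is_derive x 1 (phi (weibull_cdf k)) (k%:num / - x).
Proof.
move=> x0; have nx : 0 < - x by rewrite oppr_gt0.
apply: (@near_eq_is_derive _ _ _ (- (k%:num *: (@ln R \o -%R)))).
  near=> t; rewrite phi_weibull_cdf//; near: t; exact: lt_nbhsl.
have d1 : is_derive x 1 (@ln R \o -%R) ((- x)^-1 * -1).
  exact: (@is_derive1_comp _ _ (-%R : R -> R) x _ _ (is_derive1_ln nx)).
by apply: is_derive_eq; rewrite /GRing.scale/= mulrN1 mulrN opprK.
Unshelve. all: by end_near. Qed.

Lemma derive1_phi_weibull_cdf x : x < 0 ->
  derive1 (phi (weibull_cdf k)) x = k%:num / - x.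
Proof. by move=> /is_derive_phi_weibull_cdf ?; rewrite derive1E derive_val. Qed.

Lemma weibull_case_weibull_cdf : weibull_case (- k%:num) 0 (weibull_cdf k).
Proof.
split; [by rewrite oppr_lt0|exact: omega_weibull_cdf|].
rewrite omega_weibull_cdf /=; near=> x.
have x0 : x < 0 by near: x; exact: nbhs_left_lt.
rewrite derive1_phi_weibull_cdf// divr_gt0 ?oppr_gt0//; split => //; split.
  by have ? := is_derive_phi_weibull_cdf _ x0; exact: ex_derive.
apply: (@cvg_trans _ ((k%:num / - t) @[t --> x])).
  apply: near_eq_cvg; near=> t; rewrite derive1_phi_weibull_cdf//.
  by near: t; exact: lt_nbhsl.
rewrite derive1_phi_weibull_cdf//.
have nx : - x != 0 by rewrite oppr_eq0 lt_eqF.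
have cN : - t @[t --> x] --> - x by apply: cvgN.
exact: cvgM (cvg_cst _) (cvgV nx cN).
Unshelve. all: by end_near. Qed.

Lemma weibull_cdf_quantile (a : R) n : 0 < a -> (0 < n)%N ->
  (weibull_cdf k (0 - a) = expR (- n%:R^-1)) <-> (a `^ k%:num = n%:R^-1).
Proof.
move=> a0 n0; rewrite weibull_cdf_lt0 ?sub0r ?oppr_lt0// opprK.
by split => [/expR_inj/oppr_inj|->].
Qed.

(** The quantile condition says that the power [k] of [a n] is [n^-1]. The density then differs from
    its limit only by the last exponential factor. *)
Lemma weibull_cdf_density (a : nat -> R) n x : 0 < a n -> (0 < n)%N ->
  weibull_cdf k (0 - a n) = expR (- n%:R^-1) -> -1 < x < 0 ->
  free_density (weibull_cdf k) a (fun=> 0) n x =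
    k%:num * (- x) `^ (k%:num - 1) * expR (- ((- x) `^ k%:num / n%:R)).
Proof.
move=> a0 n0 Fa /andP[xN1 x0].
have Nx0 : 0 < - x by rewrite oppr_gt0.
have y0 : a n * x + 0 < 0 by rewrite addr0 pmulr_rlt0.
have Na0 : 0 - a n < 0 by rewrite sub0r oppr_lt0.
have NyE : - (a n * x + 0) = a n * - x by ring.
rewrite (free_density_phi _ _ _ _ (0 - a n))//; first last.
- by have ? := is_derive_phi_weibull_cdf _ y0; exact: ex_derive.
- exact: supp_weibull_cdf.
- by rewrite omega_weibull_cdf lte_fin.
- have : a n * -1 <= a n * x by rewrite ler_wpM2l// ltW.
  by lra.
rewrite derive1_phi_weibull_cdf// !phi_weibull_cdf//.
rewrite [X in _ * X]weibull_cdf_lt0// NyE.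
rewrite sub0r [- - a n]opprK powRM ?ltW// (weibull_cdf_quantile _ _ a0 n0).1//.
rewrite lnM ?posrE// [n%:R^-1 * _]mulrC; congr (_ * _).
have -> : - (- (k%:num * (ln (a n) + ln (- x))) - - (k%:num * ln (a n))) =
  k%:num * ln (- x) by ring.
rewrite powRB; last by rewrite (gt_eqF Nx0) implybT.
rewrite powRr1 ?ltW// /powR gt_eqF//.
by field; rewrite lt_eqF// gt_eqF.
Qed.

(* The discrepancy at [-t] is of order [t `^ (2 * k - 1) / n], which is
   unbounded as [t] tends to [0] when [k < 1/2]. *)
Lemma weibull_cdf_not_uniform (a : nat -> R) : k%:num < 2^-1 ->
  (\forall n \near \oo,
    0 < a n /\ weibull_cdf k (0 - a n) = expR (- n%:R^-1)) ->
  ~ {uniform [set x | -1 < x < 0],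
      free_density (weibull_cdf k) a (fun=> 0) @ \oo --> free_evd (- k%:num)}.
Proof.
move=> k2 aF /(uniform_near_dist _ _ _ _ ltr01) close.
near \oo => n.
have n0 : (0 < n)%N by near: n; exact: nbhs_infty_gt.
have n1 : 1 <= n%:R :> R by rewrite ler1n.
have nR : 0 < n%:R :> R by rewrite ltr0n.
have [a0 Fa] : 0 < a n /\ weibull_cdf k (0 - a n) = expR (- n%:R^-1) by near: n.
have close_n : forall x, -1 < x < 0 ->
    `|free_evd (- k%:num) x - free_density (weibull_cdf k) a (fun=> 0) n x| < 1.
  by near: n; exact: close.
have k0 : 0 < k%:num :> R by [].
(* The point [- t] is chosen with [t] to the power [1 - 2 * k] equal to [k / (2 * n)]. This makes
   the lower bound [k * q * (z / 2)] of the discrepancy equal to 1, against [close_n]. *)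
pose r : R := k%:num / (2 * n%:R).
pose p : R := 1 - 2 * k%:num.
have p0 : 0 < p by rewrite /p; lra.
have r0 : 0 < r by rewrite divr_gt0// mulr_gt0.
have r1 : r < 1 by rewrite ltr_pdivrMr ?mulr_gt0//; lra.
pose t := r `^ (p^-1).
have t0 : 0 < t by rewrite powR_gt0.
have t1 : t < 1.
  have <- : 1 `^ (p^-1) = 1 :> R by rewrite powR1.
  by apply: gt0_ltr_powR; rewrite ?invr_gt0// nnegrE// ltW.
have tp : t `^ p = r by rewrite -powRrM mulVf ?gt_eqF// powRr1// ltW.
have tx : -1 < - t < 0 by rewrite ltrN2 t1 oppr_lt0.
have := close_n _ tx.
rewrite weibull_cdf_density// opprK.
rewrite /free_evd oppr_gt0 (le_gtF (ltW k0)) oppr_lt0 k0 tx !opprK.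
set q := t `^ (k%:num - 1); set z := t `^ k%:num / n%:R.
rewrite -[X in X - _]mulr1 -mulrBr; apply/negP; rewrite -leNgt.
have tk0 : 0 < t `^ k%:num by rewrite powR_gt0.
have tk1 : t `^ k%:num <= 1.
  have <- : 1 `^ k%:num = 1 :> R by rewrite powR1.
  by apply: ge0_ler_powR; rewrite ?nnegrE ?ltW.
have z0 : 0 < z by rewrite divr_gt0.
have z1 : z <= 1 by rewrite ler_pdivrMr// mul1r (le_trans tk1).
(* For [0 < z <= 1], [expR (- z) <= 1 / (1 + z) <= 1 - z / 2]. *)
have ez : z / 2 <= 1 - expR (- z).
  have := expR_ge1Dx z; rewrite expRN => ez.
  have : (expR z)^-1 <= (1 + z)^-1 by rewrite lef_pV2 ?posrE ?expR_gt0//; lra.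
  have : (1 + z)^-1 <= 1 - z / 2.
    have zz : 0 <= z * (1 - z) by rewrite mulr_ge0 ?subr_ge0// ltW.
    by rewrite -[leLHS]mul1r ler_pdivrMr; lra.
  lra.
have q0 : 0 < q by rewrite powR_gt0.
have kqz : k%:num * q * (z / 2) = 1.
  have -> : k%:num * q * (z / 2) = r * (q * t `^ k%:num).
    by rewrite /z /r; field; rewrite gt_eqF.
  rewrite /q -powRD; last by rewrite (gt_eqF t0) implybT.
  have -> : k%:num - 1 + k%:num = - p by rewrite /p; ring.
  by rewrite powRN tp divff// gt_eqF.
rewrite -[leLHS]kqz; apply: le_trans _ (ler_norm _).
by rewrite ler_wpM2l// mulr_ge0 ?ltW.
Unshelve. all: by end_near. Qed.

End weibull_cdf.

(** * Assembly of the three rates and the counterexample *)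

Theorem theorem1p1 (R : realType) :
  [/\
    forall (alpha : R) (F : cumulativeBounded (0 : R) (1 : R)) (g : R -> R),
      frechet_case alpha F ->
      rate_bound F (dom_frechet F) (h_frechet alpha F) g ->
      forall a : nat -> R,
        (\forall n \near \oo, 0 < a n /\ F (a n) = expR (- n%:R^-1)) ->
        eventually_le_bigO
          (fun n => sup_dist [set x | 1 < x]
                      (free_density F a (fun=> 0) n) (free_evd alpha))
          (fun n => Num.max n%:R^-1 (g (a n))),
    forall (alpha w : R) (F : cumulativeBounded (0 : R) (1 : R)) (g : R -> R),
      weibull_case alpha w F ->
      rate_bound F (dom_weibull w F) (h_weibull alpha w F) g ->
      alpha < -1 ->
      forall a : nat -> R,
        (\forall n \near \oo, 0 < a n /\ F (w - a n) = expR (- n%:R^-1)) ->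
        eventually_le_bigO
          (fun n => sup_dist [set x | -1 < x < 0]
                      (free_density F a (fun=> w) n) (free_evd alpha))
          (fun n => Num.max n%:R^-1 (g (w - a n))),
    forall alpha : R, - 2^-1 < alpha < 0 ->
      exists F : cumulativeBounded (0 : R) (1 : R),
        [/\ forall x : R,
              F x = if x < 0 then expR (- (- x) `^ (- alpha)) else 1,
            weibull_case alpha 0 F,
            forall x : R, x < 0 -> dom_weibull 0 F x /\ h_weibull alpha 0 F x = 0,
            exists a : nat -> R,
              \forall n \near \oo, 0 < a n /\ F (0 - a n) = expR (- n%:R^-1) &
            forall a : nat -> R,
              (\forall n \near \oo, 0 < a n /\ F (0 - a n) = expR (- n%:R^-1)) ->
              ~ {uniform [set x | -1 < x < 0],
                  free_density F a (fun=> 0) @ \oo --> free_evd alpha}] &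
    forall (alpha : R) (F : cumulativeBounded (0 : R) (1 : R)) (g : R -> R),
      gumbel_case alpha F ->
      rate_bound F (dom_gumbel F) (h_gumbel F) g ->
      forall a b : nat -> R,
        (\forall n \near \oo, F (b n) = expR (- n%:R^-1) /\
                              a n = F (b n) / (n%:R * derive1 F (b n))) ->
        eventually_le_bigO
          (fun n => sup_dist [set x | 0 < x]
                      (free_density F a b n) (free_evd alpha))
          (fun n => Num.max n%:R^-1 (g (b n)))
  ].
Proof.
split.
- move=> alpha F g hF hg a; exact: frechet_rate.
- move=> alpha w F g hF hg alphaN1 a; exact: weibull_rate.
- move=> alpha /andP[alpha2 alpha0].
  have k0 : 0 < - alpha by rewrite oppr_gt0.
  pose k := PosNum k0; have alphaE : alpha = - k%:num by rewrite opprK.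
  exists (weibull_cdf k); rewrite alphaE; split.
  + by move=> x; rewrite opprK.
  + exact: weibull_case_weibull_cdf.
  + move=> x x0; have dx := is_derive_phi_weibull_cdf k _ x0; split.
      split; [by []|exact: supp_weibull_cdf|exact: ex_derive].
    rewrite /h_weibull derive1_phi_weibull_cdf//; field.
    by rewrite lt_eqF.
  (* The solution of the quantile equation; its existence keeps the failure of uniform convergence
     from being vacuous. *)
  + exists (fun n => (n%:R^-1) `^ (k%:num^-1)); near=> n.
    have n0 : (0 < n)%N by near: n; exact: nbhs_infty_gt.
    have a0 : 0 < n%:R^-1 `^ (k%:num^-1) :> R.
      by rewrite powR_gt0 ?invr_gt0 ?ltr0n.
    split => //; apply/weibull_cdf_quantile => //.
    by rewrite -powRrM mulVf ?gt_eqF// powRr1.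
  + by move=> a; apply: weibull_cdf_not_uniform; rewrite /=; lra.
- move=> alpha F g hF hg a b; exact: gumbel_rate.
Unshelve. all: by end_near. Qed.
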